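(* Let $(X,\mathbb{X},\mu)$ be a measure space and let $p\in[1,\infty)$. Let $(f_n)$ be a sequence of measurable functions on $X$. If $(f_n)$ is Cauchy almost in $L_p$, then there exists a measurable function $f$ on $X$ to which $(f_n)$ converges almost in $L_p$.
   Context: Measurable functions are $\mathbb{X}$-measurable real-valued functions on $X$; $(X,\mathbb{X},\mu)$ is an arbitrary measure space. For $E\in\mathbb{X}$, $E^c$ denotes the complement of $E$ in $X$. A sequence $(f_n)$ of measurable functions is said to be Cauchy almost in $L_p$ if for each $\delta>0$ there exists a measurable set $E_\delta$ with $\mu(E_\delta)<\delta$ such that $\int_{E_\delta^c}|f_n-f_m|^p\,d\mu\to 0$ as $n,m\to\infty$. A sequence $(f_n)$ of measurable functions is said to converge almost in $L_p$ to a measurable function $f$ if for each $\delta>0$ there exists a measurable set $E_\delta$ with $\mu(E_\delta)<\delta$ such that $\int_{E_\delta^c}|f_n-f|^p\,d\mu\to 0$ as $n\to\infty$. *)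

(* Defs.v *)
From HB Require Import structures.
From mathcomp Require Import all_boot all_order all_algebra.
From mathcomp Require Import all_classical all_reals all_analysis.

Set Implicit Arguments.
Unset Strict Implicit.
Unset Printing Implicit Defensive.

Import Order.TTheory GRing.Theory Num.Theory.
Import numFieldNormedType.Exports.

Local Open Scope classical_set_scope.
Local Open Scope ring_scope.

(* The integrals live in \bar R: convergence to 0 there means that they are
   eventually finite and tend to 0.  The double limit n, m -> oo is the limit
   along the product filter, i.e. n and m tend to infinity independently. *)
Definition cauchy_almost_Lp (d : measure_display) (T : measurableType d)
    (R : realType) (mu : {measure set T -> \bar R}) (p : R)
    (f : nat -> T -> R) : Prop :=
  forall delta : R, 0 < delta ->
    exists E : set T,
      [/\ measurable E,
          (mu E < delta%:E)%E &
          (\int[mu]_(x in ~` E) (`|f nm.1 x - f nm.2 x| `^ p)%:E)%E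
            @[nm --> filter_prod \oo \oo] --> 0%E].

Definition cvg_almost_Lp (d : measure_display) (T : measurableType d)
    (R : realType) (mu : {measure set T -> \bar R}) (p : R)
    (f : nat -> T -> R) (g : T -> R) : Prop :=
  forall delta : R, 0 < delta ->
    exists E : set T,
      [/\ measurable E,
          (mu E < delta%:E)%E &
          (\int[mu]_(x in ~` E) (`|f n x - g x| `^ p)%:E)%E
            @[n --> \oo] --> 0%E].

(* Main.v *)
Require Import Defs.
From HB Require Import structures.
From mathcomp Require Import all_boot all_order all_algebra.
From mathcomp Require Import all_classical all_reals all_analysis.
From mathcomp Require Import measurable_realfun.
Import Order.TTheory GRing.Theory Num.Theory.
Import numFieldNormedType.Exports.

Local Open Scope classical_set_scope.
Local Open Scope ring_scope.

(** The argument is that of the Riesz-Fischer theorem, run on countably many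
    exceptional sets at once.  For each [j] fix a set [E j] of measure less
    than [2^-j] off which the sequence is Cauchy for the distance
    [\int |u - v|^p].  The limit must not depend on [j], so a single
    subsequence [h] of [f] is extracted diagonally: for every [j <= k], the
    distance of [h k.+1] and [h k] off [E j] is at most [(2^-k)^p * 2^-k].

    By Markov's inequality, off [E j] the set where [|h k.+1 - h k| >= 2^-k]
    then has measure at most [2^-k] for all [k >= j]; by the Borel-Cantelli
    lemma, almost every point off [E j] lies in finitely many of these sets,
    and at such a point the real sequence [h] converges
    ([geometric_Lp_increments_ae_cvg]).  The upper limit of [h], with infinite
    values replaced by 0, is measurable and is this limit almost everywhere
    off each [E j].

    Finally, a bound on the distance of [f n] and [f m] off [E j], valid for all
    large [n] and [m], passes to the distance of [f n] and the limit on letting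
    [m] run through the subsequence, by Fatou's lemma ([Lp_dist_fatou]).  Given
    [delta], the exceptional set is [E j] for any [j] with [2^-j < delta]. *)

(** [u] is, up to its first term, the series of its increments, whose tails are
    dominated by those of the geometric series. *)
Lemma geometric_increments_cvg (R : realType) (u : R ^nat) :
  (\forall k \near \oo, `|u k.+1 - u k| <= 2^-1 ^+ k) -> cvgn u.
Proof.
move=> du.
suff : cvgn (series (telescope u)).
  rewrite telescopeK => cu; rewrite (_ : u = (fun n => u n - u 0) \+ cst (u 0)).
    by apply: is_cvgD => //; exact: is_cvg_cst.
  by apply/funext => n /=; rewrite subrK.
apply/cauchy_cvgP/cauchy_seriesP => e e0.
have : cvgn (series (geometric (1 : R) 2^-1)).
  by apply: is_cvg_geometric_series; rewrite ger0_norm// invf_lt1// ltr1n.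
move=> /cauchy_cvgP/cauchy_seriesP/(_ e e0).
case: du => N _ Nu [[A B] /= [nA nB] AB].
exists (A `&` [set n | (N <= n)%N], B).
  by split => //=; apply: filterI => //; exists N.
move=> [a b] /= [[Aa Na] Bb].
apply: le_lt_trans (AB (a, b) (conj Aa Bb)) => /=.
rewrite (le_trans (ler_norm_sum _ _ _))// [leRHS]ger0_norm; last first.
  by apply: sumr_ge0 => k _; rewrite mul1r exprn_ge0.
rewrite !big_nat; apply: ler_sum => k /andP[ak _].
by rewrite mul1r; apply: Nu; exact: leq_trans ak.
Qed.

(** Away from 0 the power is [expR (p * ln x)], hence continuous; at 0, where
    [ln] is of no help, continuity comes from monotonicity and [0 < p]. *)
Lemma cvg_norm_powR (R : realType) (p : R) (u : R ^nat) (l : R) : 0 < p ->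
  u @ \oo --> l -> `|u k| `^ p @[k --> \oo] --> `|l| `^ p.
Proof.
move=> p0 ul.
have [l0|l0] := eqVneq l 0; last first.
  have l0' : 0 < `|l| by rewrite normr_gt0.
  have c : {for `|l|, continuous (fun x : R => expR (p * ln x))}.
    apply: continuous_comp; last exact: continuous_expR.
    by apply: cvgM; [exact: cvg_cst|exact: continuous_ln].
  have {}ul : `|u k| @[k --> \oo] --> `|l| by exact: cvg_norm.
  have : expR (p * ln `|u k|) @[k --> \oo] --> expR (p * ln `|l|).
    exact: (continuous_cvg _ c ul).
  rewrite {2}/powR gt_eqF//; apply: cvg_trans; apply: near_eq_cvg.
  near=> k; rewrite /powR gt_eqF//; near: k.
  by move/cvgr_gt : ul; exact.
rewrite l0 in ul *; rewrite normr0 powR0 ?gt_eqF//; apply/cvgr0Pnorm_lt => e e0.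
have e'0 : 0 < e `^ p^-1 by exact: powR_gt0.
near=> k; rewrite ger0_norm ?powR_ge0//.
have -> : e = (e `^ p^-1) `^ p by rewrite -powRrM mulVf ?gt_eqF// powRr1// ltW.
apply: gt0_ltr_powR => //; rewrite ?nnegrE ?(ltW e'0)//; near: k.
by move/cvgr0Pnorm_lt : ul; exact.
Unshelve. all: by end_near. Qed.

Section Lp_differences.
Context d (T : measurableType d) (R : realType) (mu : {measure set T -> \bar R}).
Variables (p : R) (p0 : 0 < p).

Lemma measurable_dist_powR (D : set T) (f g : T -> R) :
  measurable_fun setT f -> measurable_fun setT g ->
  measurable_fun D (fun x => (`|f x - g x| `^ p)%:E).
Proof.
move=> mf mg; apply: (@measurable_funS _ _ _ _ setT) => //.
apply/measurable_EFinP.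
apply: (measurableT_comp (measurable_powR p)).
by apply: measurableT_comp => //; exact: measurable_funB.
Qed.

(** The factor [(2^-k)^p] in the hypothesis is the price of Markov's inequality
    at height [2^-k]; what is left, [2^-k], is summable, which is what
    Borel-Cantelli asks for. *)
Lemma geometric_Lp_increments_ae_cvg (D : set T) (h : nat -> T -> R) (N : nat) :
  measurable D -> (forall k, measurable_fun setT (h k)) ->
  (forall k, (N <= k)%N ->
    (\int[mu]_(x in D) (`|h k.+1 x - h k x| `^ p)%:E <=
     ((2^-1 ^+ k) `^ p * 2^-1 ^+ k)%:E)%E) ->
  {ae mu, forall x, D x -> cvgn (h ^~ x)}.
Proof.
move=> mD mh hN.
pose F k := if (N <= k)%N then
  D `&` [set x | (((2^-1 ^+ k) `^ p)%:E <= `|(`|h k.+1 x - h k x| `^ p)%:E|)%E]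
  else set0.
have r0 k : 0 < 2^-1 ^+ k :> R by rewrite exprn_gt0.
have mF k : measurable (F k).
  rewrite /F; case: ifP => // _; apply: emeasurable_fun_c_infty => //.
  by apply: measurableT_comp => //; exact: measurable_dist_powR.
have muF k : (mu (F k) <= (2^-1 ^+ k)%:E)%E.
  rewrite /F; case: ifPn => Nk; last by rewrite measure0 lee_fin ltW.
  have rp0 : 0 < (2^-1 ^+ k) `^ p :> R by exact: powR_gt0.
  rewrite -(@lee_pmul2l _ ((2^-1 ^+ k) `^ p)%:E)//.
  apply: le_trans (hN _ Nk).
  rewrite (eq_integral (fun x => `|(`|h k.+1 x - h k x| `^ p)%:E|%E)).
    apply: (@le_integral_comp_abse _ _ _ mu _ mD _ _ (fun x => x)) => //.
    exact: measurable_dist_powR.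
  by move=> x _; rewrite gee0_abs ?lee_fin ?powR_ge0.
(* The negligible set is that of the points lying in infinitely many [F k]. *)
exists (lim_sup_set F); split.
- apply: bigcap_measurable => // n _; exact: bigcup_measurable.
- apply: lim_sup_set_cvg0 => //.
  (* [2^-i] is written as [2 / 2^i.+1] to fit the shape of [epsilon_trick]. *)
  apply: (@le_lt_trans _ _ (\sum_(0 <= i <oo) (0 + (2%:R / (2 ^ i.+1)%:R)%:E))%E).
    apply: lee_nneseries => // k _; rewrite add0e (le_trans (muF k))// lee_fin.
    by rewrite expnS natrM invfM mulrA divff// mul1r natrX exprVn.
  apply: le_lt_trans (@epsilon_trick _ (fun=> 0%E) 2%:R xpredT _ _) _ => //.
  by rewrite eseries0// add0e ltry.
- move=> x; apply: contra_notP => nF Dx; apply: geometric_increments_cvg.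
  have [n nFn] : exists n, forall k, (n <= k)%N -> ~ F k x.
    apply: contra_notP nF => /forallNP nF n _.
    have /existsNP[k /not_implyP[nk /contrapT Fk]] := nF n.
    by exists k.
  exists (maxn n N) => // k /=; rewrite geq_max => /andP[nk Nk].
  have := nFn _ nk; rewrite /F Nk; apply: contra_notT; rewrite -ltNge => rk.
  split=> //=; rewrite lee_fin ger0_norm ?powR_ge0//.
  by apply: ge0_ler_powR; rewrite ?nnegrE ?(ltW p0)// ltW.
Qed.

(** Lower semicontinuity of the L^p distance under almost everywhere
    convergence: Fatou's lemma applied to [|u - h k|^p], whose lower limit is
    [|u - g|^p] almost everywhere. *)
Lemma Lp_dist_fatou (D : set T) (h : nat -> T -> R) (u g : T -> R) (c : \bar R) :
  measurable D -> (forall k, measurable_fun setT (h k)) ->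
  measurable_fun setT u -> measurable_fun setT g ->
  {ae mu, forall x, D x -> h ^~ x @ \oo --> g x} ->
  (\forall k \near \oo, \int[mu]_(x in D) (`|u x - h k x| `^ p)%:E <= c)%E ->
  (\int[mu]_(x in D) (`|u x - g x| `^ p)%:E <= c)%E.
Proof.
move=> mD mh mfu mg hg hc.
pose F k x := (`|u x - h k x| `^ p)%:E.
have mF k : measurable_fun D (F k) by exact: measurable_dist_powR.
have F0 k x : D x -> (0 <= F k x)%E by rewrite lee_fin powR_ge0.
rewrite (@ge0_ae_eq_integral _ _ _ mu _ _ (fun x => limn_einf (F^~ x))) //.
- apply: le_trans (fatou mu mD mF F0) _.
  rewrite limn_einf_lim; apply: lime_le; first exact: is_cvg_einfs.
  apply: filterS hc => k; apply: le_trans.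
  by apply: ereal_inf_lbound; exists k => /=.
- exact: measurable_dist_powR.
- rewrite (_ : (fun _ => _) = fun x => - limn_esup ((fun k => - F k x)%E))%E.
    apply: measurableT_comp => //; apply: measurable_fun_limn_esup => k.
    exact: measurableT_comp.
  by [].
- move=> x Dx; rewrite limn_einf_lim; apply: lime_ge; first exact: is_cvg_einfs.
  by apply: nearW => k; apply: le_ereal_inf_tmp => _ [m _ <-]; exact: F0.
- apply: filterS hg => x hg Dx; have {}hg := hg Dx.
  suff : F k x @[k --> \oo] --> (`|u x - g x| `^ p)%:E.
    by move/cvg_limn_einf_sup => [-> _].
  apply: cvg_EFin; first exact: nearW.
  apply: cvg_norm_powR => //; apply: cvgB => //; exact: cvg_cst.
Qed.

End Lp_differences.

Theorem theorem3p2 (d : measure_display) (T : measurableType d)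
    (R : realType) (mu : {measure set T -> \bar R}) (p : R) (hp : 1 <= p)
    (f : nat -> T -> R) (mf : forall n, measurable_fun setT (f n)) :
  cauchy_almost_Lp mu p f ->
  exists g : T -> R, measurable_fun setT g /\ cvg_almost_Lp mu p f g.
Proof.
move=> cf.
have p0 : 0 < p by exact: lt_le_trans hp.
have r0 k : 0 < 2^-1 ^+ k :> R by rewrite exprn_gt0.
have /choice[E Ek] : forall k : nat, exists E : set T,
    [/\ measurable E, (mu E < (2^-1 ^+ k)%:E)%E &
      forall e : R, 0 < e -> exists N, forall n m, (N <= n)%N -> (N <= m)%N ->
        (\int[mu]_(x in ~` E) (`|f n x - f m x| `^ p)%:E <= e%:E)%E].
  move=> k; have [E [mE muE cE]] := cf _ (r0 k).
  exists E; split => // e e0.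
  have /cE[[A B] /= [[a _ aA] [b _ bB]] AB] :
      nbhs (0%:E : \bar R) [set x | (x < e%:E)%E].
    by apply: open_ereal_lt'; rewrite lte_fin.
  exists (maxn a b) => n m; rewrite !geq_max => /andP[an _] /andP[_ bm].
  by apply/ltW/(AB (n, m)); split => /=; [exact: aA|exact: bB].
(* [N (j, i)] is a rank from which the distance off [E j] is within the [i]-th
   threshold required by [geometric_Lp_increments_ae_cvg]. *)
have /choice[N HN] : forall ji : nat * nat, exists N, forall n m,
    (N <= n)%N -> (N <= m)%N ->
    (\int[mu]_(x in ~` E ji.1) (`|f n x - f m x| `^ p)%:E <=
     ((2^-1 ^+ ji.2) `^ p * 2^-1 ^+ ji.2)%:E)%E.
  by move=> [j i]; have [_ _] := Ek j; apply; rewrite mulr_gt0// powR_gt0.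
(* The sum dominates every [N (j, i)] with [i, j <= l], which makes both [s k]
   and [s k.+1] large enough for the [k]-th increment; the term [l] makes [s]
   tend to infinity. *)
pose s l := (l + \sum_(j < l.+1) \sum_(i < l.+1) N (nat_of_ord j, nat_of_ord i))%N.
have Ns j i l : (j <= l)%N -> (i <= l)%N -> (N (j, i) <= s l)%N.
  rewrite -(ltnS j) -(ltnS i) => jl il.
  rewrite /s (bigD1 (Ordinal jl))//= (bigD1 (Ordinal il))//=.
  by rewrite addnCA -!addnA leq_addr.
pose h k := f (s k).
have mh k : measurable_fun setT (h k) by exact: mf.
have mE j : measurable (~` E j) by apply: measurableC; have [] := Ek j.
pose g x := fine (limn_esup (fun k => (h k x)%:E)).
have mg : measurable_fun setT g.
  apply: measurableT_comp => //; apply: measurable_fun_limn_esup => k.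
  exact/measurable_EFinP.
have hg j : {ae mu, forall x, (~` E j) x -> h ^~ x @ \oo --> g x}.
  apply: filterS (@geometric_Lp_increments_ae_cvg _ _ _ mu _ p0 _ h j (mE j) mh _).
    move=> x /[apply]/cvg_ex[l hl].
    suff : (h k x)%:E @[k --> \oo] --> l%:E.
      by rewrite /g => /cvg_limn_einf_sup[_ ->].
    by apply: cvg_EFin => //; exact: nearW.
  by move=> k jk; apply: (HN (j, k)); apply: Ns => //; exact: leqW.
exists g; split=> // e e0.
have [j je] : exists j, 2^-1 ^+ j < e.
  have [j _ /(_ j (leqnn j))] := near_infty_natSinv_expn_lt (PosNum e0).
  by rewrite /= div1r -exprVn; exists j.
have [mEj muEj cEj] := Ek j.
exists (E j); split => //; first by apply: lt_trans muEj _; rewrite lte_fin.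
have fe c : 0 < c -> \forall n \near \oo,
    (\int[mu]_(x in ~` E j) (`|f n x - g x| `^ p)%:E <= c%:E)%E.
  move=> /cEj[M fM]; exists M => // n /= Mn.
  apply: (@Lp_dist_fatou _ _ _ _ _ p0 _ h) => //.
  exists M => // k /= Mk; apply: fM => //.
  by rewrite (leq_trans Mk)// leq_addr.
have I0 n : (0 <= \int[mu]_(x in ~` E j) (`|f n x - g x| `^ p)%:E)%E.
  by apply: integral_ge0 => x _; rewrite lee_fin powR_ge0.
have If : \forall n \near \oo,
    (\int[mu]_(x in ~` E j) (`|f n x - g x| `^ p)%:E)%E \is a fin_num.
  apply: filterS (fe 1 ltr01) => n In.
  by rewrite ge0_fin_numE// (le_lt_trans In) ?ltry.
apply/fine_cvgP; split => //; apply/cvgr0Pnorm_le => c /fe fc.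
near=> n; rewrite /= ger0_norm ?fine_ge0// -lee_fin fineK; near: n => //.
Unshelve. all: by end_near. Qed.
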